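(* Let $\beta\in \mathrm{Sym}_n(\mathbb Q)$ be positive semi-definite of rank $n-1$ and let $\ell\subset V$ be a rational isotropic line. Then there is a finite number of rational $n$-dimensional subspaces $U_1,\dots,U_a$ of $\ell^\perp$ such that $$\{U_1,\dots,U_a\}=\{\mathrm{span}(X):X\in\Omega_{\beta,\ell}\cap(L^n+h)\}.$$
   Context: $V$ is a $\mathbb Q$-vector space of dimension $p+1$ with a non-degenerate symmetric bilinear form $(\,,)$ of signature $(p,1)$, having nonzero rational isotropic vectors; $L\subset V$ is a $\mathbb Z$-lattice of full rank with $L\subset L^{\#}$ (dual lattice); $1\le n\le p$ and $h\in(L^{\#})^n$. For $X=(x_1,\dots,x_n)\in V^n$, $(X,X)$ is the matrix $((x_i,x_j))$ and $R(X)$ is the radical of the subspace $\mathrm{span}(X)$, i.e. $\{u\in\mathrm{span}(X):(u,\mathrm{span}(X))=0\}$. Put $\Omega_{\beta,\ell}=\{X\in V^n:\frac12(X,X)=\beta,\ R(X)=\ell\}$; its elements have entries in $\ell^\perp$. *)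

(* Defs.v *)
From HB Require Import structures.
From mathcomp Require Import all_boot all_order all_algebra.

Set Implicit Arguments.
Unset Strict Implicit.
Unset Printing Implicit Defensive.

Import Order.TTheory GRing.Theory Num.Theory.

Local Open Scope ring_scope.

Section QuadraticSpace.

Variables (V : vectType rat) (form : {symmetric V}).
Implicit Types (U l : {vspace V}) (L : V -> Prop).

(* A symmetric form is diagonalizable over the rationals, and the signature of
   its real extension is read off any rational orthogonal basis. *)
Definition has_signature (r s : nat) : Prop :=
  exists b : (\dim {:V}).-tuple V,
    [/\ basis_of {:V} b,
        forall i j, i != j -> form (tnth b i) (tnth b j) = 0,
        #|[set i | 0 < form (tnth b i) (tnth b i)]| = r
      & #|[set i | form (tnth b i) (tnth b i) < 0]| = s].

Definition full_lattice L : Prop :=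
  exists b : (\dim {:V}).-tuple V,
    basis_of {:V} b /\ (forall v, L v <-> inIntSpan b v).

Definition dual_lattice L : V -> Prop :=
  fun v => forall w, L w -> form v w \is a Num.int.

(* [orthov form U] is the orthogonal of [U] in the whole space. *)
Definition radical U : {vspace V} := (U :&: orthov form U)%VS.

Definition isotropic_line l : Prop :=
  \dim l = 1%N /\ {in l &, forall u v, form u v = 0}.

Definition gram n (X : n.-tuple V) : 'M[rat]_n :=
  \matrix_(i, j) form (tnth X i) (tnth X j).

Definition Omega n (beta : 'M[rat]_n) l (X : n.-tuple V) : Prop :=
  2^-1 *: gram X = beta /\ radical <<X>> = l.

Definition lattice_coset L n (h X : n.-tuple V) : Prop :=
  forall i, L (tnth X i - tnth h i).

End QuadraticSpace.

Definition possemidef n (beta : 'M[rat]_n) : Prop :=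
  forall x : 'rV[rat]_n, 0 <= (x *m beta *m x^T) 0 0.

(* Main.v *)
Require Import Defs.
From mathcomp Require Import all_boot all_order all_algebra.
From mathcomp Require Import ring lra.
From Stdlib Require Import Classical.

Set Implicit Arguments.
Unset Strict Implicit.
Unset Printing Implicit Defensive.

Import Order.TTheory GRing.Theory Num.Theory.

Local Open Scope ring_scope.

(* The rank of [beta] forces [span X] to have dimension [n]. As the radical [l]
   of [span X] lies in [span X], the span depends on [X] only modulo [l]. Fix
   lattice vectors [w_j] spanning [l^perp]. Since [l^perp] is positive
   semi-definite with radical [l], the vector [x_i] is determined modulo [l] by
   the numbers [(x_i, w_j)]. These are integers, as [x_i] is in the dual
   lattice, and they are bounded in terms of [(x_i, x_i) = 2 beta_ii] and
   [(w_j, w_j)]. So they take finitely many values. *)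

Section SymmetricForm.

Variables (V : vectType rat) (form : {symmetric V}).
Implicit Types (u v w x y : V).

Lemma symformC u v : form u v = form v u.
Proof. by rewrite hermC expr0 mul1r. Qed.

Lemma symform_norm_comb (a b : rat) x u :
  form (a *: x - b *: u) (a *: x - b *: u) =
  a ^+ 2 * form x x - 2 * a * b * form u x + b ^+ 2 * form u u.
Proof.
rewrite !(linearBl, linearBr) /= !(linearZl_LR, linearZr_LR) /=.
rewrite (symformC x u); ring.
Qed.

Lemma signature_timelike p : \dim {:V} = p.+1 -> has_signature form p 1 ->
  exists e, forall y, form y e = 0 -> y != 0 -> 0 < form y y.
Proof.
move=> dimV [b [b_basis b_orth b_pos /eqP/cards1P[i0 negE]]].
have q0_lt0 : form (tnth b i0) (tnth b i0) < 0.
  by have := set11 i0; rewrite -negE inE.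
have q_gt0 i : i != i0 -> 0 < form (tnth b i) (tnth b i).
  suff posE : [set i | 0 < form (tnth b i) (tnth b i)] = [set~ i0].
    by move=> ne; have := in_setC1 i i0; rewrite ne -posE inE.
  apply/eqP; rewrite eqEcard b_pos cardsC1 card_ord.
  have -> : ((\dim {:V}).-1 <= p)%N by rewrite dimV.
  rewrite andbT; apply/subsetP => j; rewrite inE in_setC1; apply: contraTneq => ->.
  by rewrite -leNgt ltW.
exists (tnth b i0) => y y_e0 y_neq0.
set c := fun i => coord b i y.
have yE : y = \sum_i c i *: tnth b i.
  rewrite {1}(coord_basis b_basis (memvf y)).
  by apply: eq_bigr => i _; rewrite (tnth_nth 0).
have formyE j : form y (tnth b j) = c j * form (tnth b j) (tnth b j).
  rewrite {1}yE linear_sumlz (bigD1 j) //= linearZl_LR /= big1 ?addr0 // => i ne.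
  by rewrite linearZl_LR /= b_orth ?mulr0.
have c0 : c i0 = 0.
  move/eqP: y_e0; rewrite formyE mulf_eq0 => /orP[/eqP//|].
  by rewrite lt_eqF.
have formyyE : form y y = \sum_i c i ^+ 2 * form (tnth b i) (tnth b i).
  rewrite {2}yE linear_sumr; apply: eq_bigr => i _.
  by rewrite linearZr_LR /= formyE mulrA.
have term_ge0 i : 0 <= c i ^+ 2 * form (tnth b i) (tnth b i).
  have [->|ne] := eqVneq i i0; first by rewrite c0 expr0n mul0r.
  by rewrite mulr_ge0 ?sqr_ge0 // ltW // q_gt0.
rewrite lt_def formyyE sumr_ge0 ?andbT //.
apply: contra y_neq0 => /eqP/psumr_eq0P c_eq0.
rewrite yE big1 // => i _.
have [->|ne] := eqVneq i i0; first by rewrite c0 scale0r.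
have /eqP := c_eq0 (fun i _ => term_ge0 i) i isT.
rewrite mulf_eq0 (gt_eqF (q_gt0 i ne)) orbF sqrf_eq0 => /eqP->.
by rewrite scale0r.
Qed.

Section Lorentzian.

Variables (e u : V).
Hypothesis e_timelike : forall y, form y e = 0 -> y != 0 -> 0 < form y y.
Hypotheses (u_neq0 : u != 0) (u_isotropic : form u u = 0).

Lemma isotropic_timelike_neq0 : form u e != 0.
Proof.
by apply/eqP => /e_timelike/(_ u_neq0); rewrite u_isotropic ltxx.
Qed.

(* The combination of [x] and [u] orthogonal to [e] has the norm of [x] up to a
   positive factor. *)
Lemma isotropic_orth_reduction x (y := form u e *: x - form x e *: u) :
  form u x = 0 -> form y e = 0 /\ form y y = form u e ^+ 2 * form x x.
Proof.
move=> ux; split; last by rewrite symform_norm_comb ux u_isotropic !mulr0 subr0 addr0.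
by rewrite linearBl /= !linearZl_LR /= mulrC subrr.
Qed.

Lemma isotropic_orth_ge0 x : form u x = 0 -> 0 <= form x x.
Proof.
move=> /isotropic_orth_reduction[].
set y := _ - _ => ye yy.
have uegt0 : 0 < form u e ^+ 2 by rewrite exprn_even_gt0 //= isotropic_timelike_neq0.
rewrite -(pmulr_rge0 _ uegt0) -yy.
have [->|/(e_timelike ye)/ltW//] := eqVneq y 0.
by rewrite linear0l.
Qed.

Lemma isotropic_orth_eq0 x : form u x = 0 -> form x x = 0 -> x \in <[u]>%VS.
Proof.
move=> /isotropic_orth_reduction[].
set y := _ - _ => ye yy xx.
have /eqP : y = 0.
  apply: contraTeq isT => /(e_timelike ye).
  by rewrite yy xx mulr0 ltxx.
rewrite subr_eq0 => /eqP xE; apply/vlineP.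
exists ((form u e)^-1 * form x e).
by rewrite -scalerA -xE scalerA mulVf ?scale1r // isotropic_timelike_neq0.
Qed.

Lemma isotropic_orth_form_bound x w : form u x = 0 -> form u w = 0 ->
  `|form x w| <= form x x + form w w.
Proof.
move=> ux uw.
have := @isotropic_orth_ge0 (1 *: x - 1 *: w).
have := @isotropic_orth_ge0 (1 *: x - (-1) *: w).
rewrite !symform_norm_comb !linearBr /= !linearZr_LR /= ux uw !mulr0 subr0.
move=> /(_ erefl) h1 /(_ erefl) h2.
have := isotropic_orth_ge0 ux; have := isotropic_orth_ge0 uw.
rewrite (symformC w x) in h1 h2.
by rewrite ler_norml => h3 h4; apply/andP; split; lra.
Qed.

End Lorentzian.

Lemma full_lattice_multiple (L : V -> Prop) v : full_lattice L ->
  exists2 d : int, d != 0 & L (v *~ d).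
Proof.
case=> b [b_basis LE].
pose d i := denq (coord b i v).
exists (\prod_i d i).
  by apply/prodf_neq0 => i _; rewrite denq_neq0.
rewrite LE; exists [ffun i => numq (coord b i v) * \prod_(j | j != i) d j].
rewrite {1}(coord_basis b_basis (memvf v)) mulrz_suml.
apply: eq_bigr => i _; rewrite ffunE -!scaler_int scalerA.
by congr (_ *: _); rewrite (bigD1 i) //= !intrM numqE; ring.
Qed.

Lemma lincomb_gram n (X : n.-tuple V) (c : 'rV[rat]_n) j :
  (c *m gram form X) 0 j = form (\sum_i c 0 i *: X`_i) (tnth X j).
Proof.
rewrite mxE linear_sumlz; apply: eq_bigr => i _.
by rewrite mxE linearZl_LR /= (tnth_nth 0).
Qed.

Lemma free_of_gram_rank n (X : n.-tuple V) u : (0 < n)%N ->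
  \rank (gram form X) = n.-1 -> u != 0 -> u \in radical form <<X>> -> free X.
Proof.
move=> n_gt0 rk u_neq0; rewrite memv_cap => /andP[uX /mem_orthovP u_orth].
pose c := \row_i coord X i u.
have cE : u = \sum_i c 0 i *: X`_i.
  by rewrite {1}(coord_span uX); apply: eq_bigr => i _; rewrite mxE.
have c_neq0 : c != 0.
  apply: contra u_neq0 => /eqP c0; rewrite cE c0 big1 // => i _.
  by rewrite mxE scale0r.
have c_ker : (c <= kermx (gram form X))%MS.
  apply/sub_kermxP/rowP => j; rewrite lincomb_gram -cE mxE u_orth //.
  by rewrite memv_span // mem_tnth.
have [_ ] := mxrank_leqif_eq c_ker.
rewrite mxrank_ker rk rank_rV c_neq0 -subn1 subKn // eqxx => /esym/andP[_ ker_c].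
apply/freeP => k k0 i.
have : (\row_i k i <= c)%MS.
  apply: submx_trans ker_c; apply/sub_kermxP/rowP => j.
  rewrite lincomb_gram mxE (eq_bigr (fun i => k i *: X`_i)) ?k0 ?linear0l //.
  by move=> ? _; rewrite mxE.
case/sub_rVP => a kE.
have kiE j : k j = a * c 0 j by move/rowP/(_ j): kE; rewrite !mxE.
move/eqP: k0; under eq_bigr do rewrite kiE -scalerA.
rewrite -scaler_sumr -cE scaler_eq0 (negPf u_neq0) orbF => /eqP a0.
by rewrite kiE a0 mul0r.
Qed.

End SymmetricForm.

Lemma sub_span_mod (V : vectType rat) n (X Y : n.-tuple V) (l : {vspace V}) :
  (forall i, tnth X i - tnth Y i \in l) -> (l <= <<Y>>)%VS -> (<<X>> <= <<Y>>)%VS.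
Proof.
move=> XY lY; apply/span_subvP => _ /tnthP[i ->].
rewrite -(subrK (tnth Y i) (tnth X i)) memvD //.
  exact/(subvP lY)/XY.
by rewrite memv_span // mem_tnth.
Qed.

Lemma finite_classification (T : eqType) (K : finType) (P : T -> K -> Prop) :
  (forall t t' k, P t k -> P t' k -> t = t') ->
  exists s : seq T, forall t, t \in s <-> exists k, P t k.
Proof.
move=> P_inj.
suff [s sE] : exists s : seq T, forall t, t \in s <-> exists2 k, k \in enum K & P t k.
  exists s => t; rewrite sE.
  by split=> [[k _]|[k]]; exists k; rewrite ?mem_enum.
elim: (enum K) => [|k ks [s sE]]; first by exists [::] => t; split=> // -[].
have [[t0 Pt0]|noP] := classic (exists t, P t k).
- exists (t0 :: s) => t; rewrite inE; split=> [/predU1P[->|/sE[k' k'ks Pt]]|[k']].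
  + by exists k; rewrite ?mem_head.
  + by exists k'; rewrite // inE k'ks orbT.
  + rewrite inE => /predU1P[-> /P_inj/(_ Pt0)->|k'ks Pt]; first by rewrite eqxx.
    by apply/orP; right; apply/sE; exists k'.
- exists s => t; rewrite sE; split=> -[k'].
    by move=> k'ks; exists k'; rewrite // inE k'ks orbT.
  rewrite inE => /predU1P[->|]; last by exists k'.
  by move=> Pt; case: noP; exists t.
Qed.

Lemma finite_nat_bound (I : finType) (q : I -> rat) :
  exists B : nat, forall i, q i <= B%:R.
Proof.
exists (\sum_i Num.bound `|q i|)%N => i.
apply: le_trans (ler_norm _) _.
apply: le_trans (ltW (archi_boundP (normr_ge0 _))) _.
by rewrite ler_nat (bigD1 i) //= leq_addr.
Qed.

Lemma bounded_int_ord (B : nat) (q : rat) : q \is a Num.int -> `|q| <= B%:R ->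
  exists k : 'I_(B + B).+1, q = k%:R - B%:R.
Proof.
case/intrP => z ->; rewrite ler_norml => /andP[z_ge z_le].
have : (0 <= z + B%:Z) by rewrite -(ler0z rat) intrD; lra.
case zE: (z + B%:Z) => [k|] // _.
have k_lt : (k < (B + B).+1)%N.
  rewrite ltnS -(ler_nat rat) natrD.
  have -> : k%:R = z%:~R + B%:R :> rat by rewrite -[k%:R]/(k%:Z%:~R) -zE intrD.
  lra.
exists (Ordinal k_lt) => /=.
by rewrite -[k%:R]/(k%:Z%:~R) -zE intrD addrK.
Qed.

Theorem lemma3p2 (p n : nat) (V : vectType rat) (form : {symmetric V})
    (L : V -> Prop) (h : n.-tuple V) (beta : 'M[rat]_n) (l : {vspace V})
    (dimV : \dim {:V} = p.+1)
    (form_nondeg : nondegenerate form)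
    (form_sign : has_signature form p 1)
    (form_isotropic : exists v : V, v != 0 /\ form v v = 0)
    (L_lattice : full_lattice L)
    (L_sub_dual : forall v, L v -> dual_lattice form L v)
    (n_bounds : (1 <= n <= p)%N)
    (h_dual : forall i, dual_lattice form L (tnth h i))
    (beta_sym : beta \is symmetricmx)
    (beta_psd : possemidef beta)
    (beta_rank : \rank beta = n.-1)
    (l_isotropic : isotropic_line form l) :
  exists Us : seq {vspace V},
    (forall U, U \in Us -> \dim U = n /\ (U <= orthov form l)%VS) /\
    (forall U, U \in Us <->
       exists X : n.-tuple V,
         [/\ Omega form beta l X, lattice_coset L h X & U = <<X>>%VS]).
Proof.
have [e e_timelike] := signature_timelike dimV form_sign.
have [dim_l l_iso] := l_isotropic.
set u := vpick l.
have u_neq0 : u != 0 by rewrite vpick0 -dimv_eq0 dim_l.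
have ul : u \in l := memv_pick l.
have lE : l = <[u]>%VS.
  by apply/esym/eqP; rewrite eqEdim -memvE ul dim_l dim_vline u_neq0.
have u_iso : form u u = 0 by apply: l_iso.
set W := orthov form l.
have W_orth w : w \in W -> form u w = 0.
  by move=> /mem_orthovP/(_ u ul); rewrite symformC.
pose w := fun j : 'I_(\dim W) => (vbasis W)`_j.
have wW j : w j \in W by rewrite vbasis_mem // mem_nth // size_tuple.
have [d d_neq0 dL] : exists2 d : 'I_(\dim W) -> int,
    forall j, d j != 0 & forall j, L (w j *~ d j).
  have /fin_all_exists[d dP] : forall j, exists d : int, d != 0 /\ L (w j *~ d).
    by move=> j; have [d] := full_lattice_multiple (w j) L_lattice; exists d.
  by exists d => j; case: (dP j).
have [B BP] := finite_nat_bound (fun ij : 'I_n * 'I_(\dim W) =>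
  2 * beta ij.1 ij.1 + form (w ij.2 *~ d ij.2) (w ij.2 *~ d ij.2)).
have gramE X : Omega form beta l X -> gram form X = 2 *: beta.
  by case=> <- _; rewrite scalerA mulfV // scale1r.
have rad_sub X : Omega form beta l X -> (l <= <<X>>)%VS.
  by case=> _ <-; apply: capvSl.
have span_W X : Omega form beta l X -> (<<X>> <= W)%VS.
  by case=> _ lX; rewrite orthov_sym -lX capvSr.
have mem_W X i : Omega form beta l X -> tnth X i \in W.
  by move=> /span_W/subvP; apply; rewrite memv_span ?mem_tnth.
have dim_span X : Omega form beta l X -> \dim <<X>> = n.
  move=> OX; suff : free X by rewrite /free size_tuple => /eqP.
  apply: (free_of_gram_rank (form := form) (u := u)) => //.
  - by case/andP: n_bounds.
  - by rewrite (gramE X OX) -beta_rank eqmx_scale.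
  - by case: OX => _ ->.
pose K := {ffun 'I_n * 'I_(\dim W) -> 'I_(B + B).+1}.
pose P (U : {vspace V}) (k : K) := exists X : n.-tuple V,
  [/\ Omega form beta l X, lattice_coset L h X, U = <<X>>%VS &
      forall i j, form (tnth X i) (w j *~ d j) = (k (i, j))%:R - B%:R].
have key_sub X Y (k : K) : Omega form beta l X -> Omega form beta l Y ->
    (forall i j, form (tnth X i) (w j *~ d j) = (k (i, j))%:R - B%:R) ->
    (forall i j, form (tnth Y i) (w j *~ d j) = (k (i, j))%:R - B%:R) ->
    (<<X>> <= <<Y>>)%VS.
  move=> OX OY kX kY; apply: (sub_span_mod (l := l)) (rad_sub _ OY) => i.
  set z := _ - _.
  have zW : z \in W by rewrite memvB ?mem_W.
  have zw j : form z (w j) = 0.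
    have : form z (w j *~ d j) = 0 by rewrite linearBl /= kX kY subrr.
    rewrite -scaler_int linearZr_LR /= => /eqP.
    by rewrite mulf_eq0 intr_eq0 (negPf (d_neq0 j)) => /eqP.
  rewrite lE; apply: isotropic_orth_eq0 e_timelike _ _ _ _ _ => //.
    exact: W_orth.
  rewrite {2}(coord_vbasis zW) linear_sumr big1 // => j _.
  by rewrite linearZr_LR /= zw mulr0.
have P_inj U U' k : P U k -> P U' k -> U = U'.
  case=> X [OX _ -> kX] [Y [OY _ -> kY]].
  by apply/eqP; rewrite eqEsubv (key_sub _ _ k) // (key_sub _ _ k).
have [Us UsE] := finite_classification P_inj.
exists Us; split=> [U /UsE[k [X [OX _ -> _]]]|U].
  by split; [apply: dim_span | apply: span_W].
rewrite UsE; split=> [[k [X [OX LX UX _]]]|[X [OX LX UX]]]; first by exists X.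
suff /fin_all_exists[k kP] : forall ij, exists k : 'I_(B + B).+1,
    form (tnth X ij.1) (w ij.2 *~ d ij.2) = k%:R - B%:R.
  by exists (finfun k), X; split=> // i j; rewrite ffunE (kP (i, j)).
move=> [i j] /=; apply: bounded_int_ord.
  rewrite -(subrK (tnth h i) (tnth X i)) linearDl /= rpredD //.
    exact: L_sub_dual.
  exact: h_dual.
apply: le_trans (BP (i, j)) => /=.
have wdW : w j *~ d j \in W by rewrite rpredMz.
have -> : 2 * beta i i = form (tnth X i) (tnth X i).
  by have /matrixP/(_ i i) := gramE X OX; rewrite !mxE.
apply: (isotropic_orth_form_bound e_timelike u_neq0 u_iso); apply: W_orth => //.
exact: mem_W.
Qed.
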